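(* Let $\lambda>0$ and $q\ge0$, and take $h(\lambda,q)=\lambda^{1-q}$ in the definition of the Tsallis hypoentropies. Let $X,Y,Z$ be discrete random variables with $n$, $m$, $l$ values respectively and joint probabilities $p(x_i,y_j,z_k)$. Then $$H_{\lambda,q}(X,Y,Z)=H_{\lambda,q}(X|Y,Z)+H_{\lambda,q}(Y,Z).$$
   Context: The $q$-logarithm is $\ln_q(x)=\frac{x^{1-q}-1}{1-q}$ for $x>0$, $q\neq 1$, with $\ln_1=\log$ (the limit $q\to1$). Put $p(y_j,z_k)=\sum_i p(x_i,y_j,z_k)$. With $h(\lambda,q)=\lambda^{1-q}$, the joint Tsallis hypoentropies are $$H_{\lambda,q}(X,Y,Z)=\lambda^{-q}\left\{-(1+\lambda)\ln_q\frac{1}{1+\lambda}+\sum_{i,j,k}(1+\lambda p(x_i,y_j,z_k))\ln_q\frac{1}{1+\lambda p(x_i,y_j,z_k)}\right\},$$ $$H_{\lambda,q}(Y,Z)=\lambda^{-q}\left\{-(1+\lambda)\ln_q\frac{1}{1+\lambda}+\sum_{j,k}(1+\lambda p(y_j,z_k))\ln_q\frac{1}{1+\lambda p(y_j,z_k)}\right\},$$ and the Tsallis conditional hypoentropy of $X$ given $(Y,Z)$ is $$H_{\lambda,q}(X|Y,Z)=\sum_{j=1}^m\sum_{k=1}^l p(y_j,z_k)^q\,(\lambda p(y_j,z_k))^{-q}\left\{-(1+\lambda p(y_j,z_k))\ln_q\frac{1}{1+\lambda p(y_j,z_k)}+\sum_{i=1}^n(1+\lambda p(x_i,y_j,z_k))\ln_q\frac{1}{1+\lambda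 p(x_i,y_j,z_k)}\right\},$$ where summands with $p(y_j,z_k)=0$ are defined to be $0$. *)

(* Defs.v *)
From HB Require Import structures.
From mathcomp Require Import all_boot all_order all_algebra.
From mathcomp Require Import all_classical all_reals all_analysis.
Set Implicit Arguments.
Unset Strict Implicit.
Unset Printing Implicit Defensive.
Import Order.TTheory GRing.Theory Num.Theory.
Import numFieldNormedType.Exports.
Local Open Scope classical_set_scope.
Local Open Scope ring_scope.

(* A discrete random variable with n values is a map to 'I_n, the index i
   standing for the value x_i, whose fibres are events. *)
Definition discrete_rv (d : measure_display) (T : measurableType d) (n : nat)
    (X : T -> 'I_n) : Prop :=
  forall i : 'I_n, measurable (X @^-1` [set i]).

Definition joint_prob (d : measure_display) (T : measurableType d)
    (R : realType) (P : probability T R) (n m l : nat)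
    (X : T -> 'I_n) (Y : T -> 'I_m) (Z : T -> 'I_l)
    (i : 'I_n) (j : 'I_m) (k : 'I_l) : R :=
  fine (P (X @^-1` [set i] `&` Y @^-1` [set j] `&` Z @^-1` [set k])).

Definition marginal_yz (R : realType) (n m l : nat)
    (p : 'I_n -> 'I_m -> 'I_l -> R) (j : 'I_m) (k : 'I_l) : R :=
  \sum_(i < n) p i j k.

Definition lnq (R : realType) (q x : R) : R :=
  if q == 1 then ln x else (x `^ (1 - q) - 1) / (1 - q).

(* The three hypoentropies below are those for h(lambda, q) = lambda^(1-q): the
   general prefactor h(lambda, q) / lambda is then lambda^(-q). *)
Definition hypoentropy_xyz (R : realType) (lambda q : R) (n m l : nat)
    (p : 'I_n -> 'I_m -> 'I_l -> R) : R :=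
  lambda `^ (- q) *
  (- (1 + lambda) * lnq q (1 / (1 + lambda)) +
   \sum_(i < n) \sum_(j < m) \sum_(k < l)
     (1 + lambda * p i j k) * lnq q (1 / (1 + lambda * p i j k))).

Definition hypoentropy_yz (R : realType) (lambda q : R) (n m l : nat)
    (p : 'I_n -> 'I_m -> 'I_l -> R) : R :=
  lambda `^ (- q) *
  (- (1 + lambda) * lnq q (1 / (1 + lambda)) +
   \sum_(j < m) \sum_(k < l)
     (1 + lambda * marginal_yz p j k) *
       lnq q (1 / (1 + lambda * marginal_yz p j k))).

Definition cond_hypoentropy_x_yz (R : realType) (lambda q : R) (n m l : nat)
    (p : 'I_n -> 'I_m -> 'I_l -> R) : R :=
  \sum_(j < m) \sum_(k < l)
    (if marginal_yz p j k == 0 then 0 else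
    marginal_yz p j k `^ q * (lambda * marginal_yz p j k) `^ (- q) *
    (- (1 + lambda * marginal_yz p j k) *
        lnq q (1 / (1 + lambda * marginal_yz p j k)) +
     \sum_(i < n)
       (1 + lambda * p i j k) * lnq q (1 / (1 + lambda * p i j k)))).

(* Main.v *)
(* Where s = p(y_j, z_k) > 0, the weight s^q (lambda s)^(-q) is lambda^(-q),
   the prefactor of the two joint hypoentropies; where s = 0, all the
   p(x_i, y_j, z_k) vanish and the bracket is 0 because ln_q 1 = 0.  So the
   conditional hypoentropy is lambda^(-q) times a sum in which the terms in
   p(y_j, z_k) cancel against those of H(Y, Z). *)
Require Import Defs.
From mathcomp Require Import all_boot all_order all_algebra.
From mathcomp Require Import all_classical all_reals all_analysis.
Import Order.TTheory GRing.Theory Num.Theory.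
Local Open Scope ring_scope.

Lemma lnq1 (R : realType) (q : R) : lnq q 1 = 0.
Proof. by rewrite /lnq; case: ifP; rewrite ?ln1 // powR1 subrr mul0r. Qed.

Lemma joint_prob_ge0 (d : measure_display) (T : measurableType d)
    (R : realType) (P : probability T R) (n m l : nat)
    (X : T -> 'I_n) (Y : T -> 'I_m) (Z : T -> 'I_l) i j k :
  0 <= joint_prob P X Y Z i j k.
Proof. exact/fine_ge0/measure_ge0. Qed.

(** The power of the product splits, leaving s^q s^(-q) = s^0 = 1. *)
Lemma powR_mul_cancel (R : realType) (lambda q s : R) :
  0 < lambda -> 0 < s -> s `^ q * (lambda * s) `^ (- q) = lambda `^ (- q).
Proof.
move=> lambda_gt0 s_gt0; rewrite powRM ?ltW // mulrCA -powRD ?subrr.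
  by rewrite powRr0 mulr1.
(* Merging exponents of sum 0 needs a nonzero base: 0^q 0^(-q) is 0 for q nonzero, but 0^0 = 1. *)
by apply/implyP => _; rewrite gt_eqF.
Qed.

Lemma cond_hypoentropy_x_yzE (R : realType) (lambda q : R) (n m l : nat)
    (p : 'I_n -> 'I_m -> 'I_l -> R) :
  0 < lambda -> (forall i j k, 0 <= p i j k) ->
  cond_hypoentropy_x_yz lambda q p =
  lambda `^ (- q) * \sum_(j < m) \sum_(k < l)
    (\sum_(i < n) (1 + lambda * p i j k) * lnq q (1 / (1 + lambda * p i j k)) -
     (1 + lambda * marginal_yz p j k) *
       lnq q (1 / (1 + lambda * marginal_yz p j k))).
Proof.
move=> lambda_gt0 p_ge0; rewrite mulr_sumr; apply: eq_bigr => j _.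
rewrite mulr_sumr; apply: eq_bigr => k _.
have s_ge0 : 0 <= marginal_yz p j k by exact: sumr_ge0.
have lnq_at0 : lnq q (1 / (1 + lambda * 0)) = 0.
  by rewrite mulr0 addr0 divr1 lnq1.
case: ifPn => [/eqP s0|s_neq0]; last first.
  have s_gt0 : 0 < marginal_yz p j k by rewrite lt_def s_neq0.
  by rewrite powR_mul_cancel // mulNr addrC.
(* Nonnegative terms with zero sum all vanish, so the default value 0 agrees with the bracket. *)
have p0 i : p i j k = 0.
  by apply: (psumr_eq0P _ s0) => // i' _; exact: p_ge0.
rewrite s0 lnq_at0 mulr0 subr0 big1 ?mulr0 // => i _.
by rewrite p0 lnq_at0 mulr0.
Qed.

Theorem lemma4p6 (R : realType) (d : measure_display) (T : measurableType d)
    (P : probability T R) (n m l : nat)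
    (X : T -> 'I_n) (Y : T -> 'I_m) (Z : T -> 'I_l)
    (hX : discrete_rv X) (hY : discrete_rv Y) (hZ : discrete_rv Z)
    (lambda q : R) (lambda_gt0 : 0 < lambda) (q_ge0 : 0 <= q) :
  let p := joint_prob P X Y Z in
  hypoentropy_xyz lambda q p =
    cond_hypoentropy_x_yz lambda q p + hypoentropy_yz lambda q p.
Proof.
move=> p; rewrite cond_hypoentropy_x_yzE //; last first.
  by move=> i j k; exact: joint_prob_ge0.
rewrite /hypoentropy_xyz /hypoentropy_yz -mulrDr; congr (_ * _).
(* The constant term in [1 + lambda] is common to both sides. Moving the sum over [i] innermost then
   allows comparison for each pair [j], [k], where the marginal term cancels. *)
rewrite addrCA; congr (_ + _); rewrite -big_split exchange_big /=.
apply: eq_bigr => j _; rewrite -big_split exchange_big /=.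
by apply: eq_bigr => k _; rewrite subrK.
Qed.
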